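(* Let $(X,d)$ be a metric space and let $A(X,d)$, $TA(X,d)$, $T(X,d)$, $T(X,d)^{\nearrow}$ be as defined in the context. If $TA(X,d)$ is well founded, then $T(X,d)^{\nearrow}$ is also well founded, and $$\mathrm{Ord}\,A(X,d)^{\sigma}=\mathrm{rank}_{TA(X,d)}(\sigma)=\mathrm{rank}_{T(X,d)^{\nearrow}}(\sigma)\quad\text{for }\sigma\in TA(X,d).$$ Also, $\mathrm{Ord}\,A(X,d)=\infty \iff \mathrm{rank}\,TA(X,d)=\infty \iff \mathrm{rank}\,T(X,d)=\infty$.
   Context: $\mathbb{N}=\{1,2,3,\dots\}$. Metrics take finite values. $\omega^*$ is the set of all finite sequences of natural numbers, including the empty sequence $\emptyset$; $s(i)$ is the $i$-th term of $s$, and $|s|$ its length. A tree is a subset of $\omega^*$ closed under taking prefixes; it is well founded if it has no infinite branch. For $s$ in a well founded tree $T$, $\mathrm{rank}_T(s)=0$ if $s$ is a leaf (no proper extension of $s$ is in $T$), and otherwise $\mathrm{rank}_T(s)=\sup\{\mathrm{rank}_T(s^\wedge n)+1 : n\in\mathbb{N},\ s^\wedge n\in T\}$, where $s^\wedge n$ is $s$ extended by one term $n$. $\mathrm{rank}\,T=\mathrm{rank}_T(\emptyset)$, and $\mathrm{rank}\,T=\infty$ if $T$ is not well founded. A family $\mathcal{A}$ of subsets of a metric space is uniformly bounded if there is $C\ge 0$ with $\mathrm{diam}\,A\le C$ for all $A\in\mathcal{A}$; it is $r$-disjoint ($r>0$) if $d(A_1,A_2)\ge r$ for all $A_1,A_2\in\mathcal{A}$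 with $A_1\neq A_2$, where $d(A_1,A_2)=\inf\{d(a_1,a_2):a_1\in A_1,\ a_2\in A_2\}$. $\mathrm{Fin}\,\mathbb{N}$ is the set of all finite nonempty subsets of $\mathbb{N}$. For $M\subset \mathrm{Fin}\,\mathbb{N}$ and $\sigma\in\{\emptyset\}\cup\mathrm{Fin}\,\mathbb{N}$ put $M^\sigma=\{\tau\in\mathrm{Fin}\,\mathbb{N} : \tau\cup\sigma\in M,\ \tau\cap\sigma=\emptyset\}$ and $M^a=M^{\{a\}}$. Define $\mathrm{Ord}\,M$ inductively: $\mathrm{Ord}\,M=0$ iff $M=\emptyset$; for ordinals $\alpha>0$, $\mathrm{Ord}\,M\le\alpha$ iff $\mathrm{Ord}\,M^a<\alpha$ for every $a\in\mathbb{N}$; $\mathrm{Ord}\,M=\alpha$ iff $\mathrm{Ord}\,M\le\alpha$ and it is not true that $\mathrm{Ord}\,M<\alpha$; $\mathrm{Ord}\,M=\infty$ iff $\mathrm{Ord}\,M>\alpha$ for every ordinal $\alpha$. $A(X,d)$ is the set of $\sigma\in\mathrm{Fin}\,\mathbb{N}$ for which there do not exist families $\mathcal{V}_i$ ($i\in\sigma$) of subsets of $X$ such that each $\mathcal{V}_i$ is $i$-disjoint and $\bigcup_{i\in\sigma}\mathcal{V}_i$ is uniformly bounded and covers $X$. $T(X,d)$ is the tree of all $s\in\omega^*$ for which there do not exist families $\mathcal{V}_1,\dots,\mathcal{V}_{|s|}$ of subsets of $X$ such that each $\mathcal{V}_i$ is $s(i)$-disjoint and $\bigcup_i\mathcal{V}_i$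 is uniformly bounded and covers $X$. $T(X,d)^{\nearrow}$ is the tree of strictly increasing sequences belonging to $T(X,d)$. Finite subsets of $\mathbb{N}$ are identified with strictly increasing finite sequences. $TA(X,d)$ is the tree of strictly increasing finite sequences, with root the empty sequence, in which a nonempty $\sigma$ belongs to $TA(X,d)$ iff $A(X,d)^{\mathrm{father}(\sigma)}\neq\emptyset$, where $\mathrm{father}(\sigma)$ is $\sigma$ with its last term deleted. *)

(* Defs.v *)
(* MathComp-Analysis *)
From HB Require Import structures.
From mathcomp Require Import all_boot all_order all_algebra finmap.
From mathcomp Require Import all_classical all_reals all_analysis.

Set Implicit Arguments.
Unset Strict Implicit.
Unset Printing Implicit Defensive.

Import Order.TTheory GRing.Theory Num.Theory.

Local Open Scope classical_set_scope.
Local Open Scope ring_scope.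

(** * Ordinals

    An ordinal is given by a family of ordinals: [sup_succ f] is the least
    ordinal strictly above all the [f i], and every ordinal is of this form
    (take the family of its elements).  One ordinal has many presentations, so
    equality of ordinals is [ord_eq], not Leibniz equality. *)

Inductive ord : Type := sup_succ (J : Type) (f : J -> ord).

(* [sup_succ f <= b] iff [f i < b] for all [i];
   [a < sup_succ g] iff [a <= g j] for some [j]. *)
Fixpoint ord_le (a b : ord) {struct a} : Prop :=
  let: sup_succ J f := a in
  forall i : J, let: sup_succ K g := b in exists j : K, ord_le (f i) (g j).

Definition ord_lt (a b : ord) : Prop :=
  let: sup_succ K g := b in exists j : K, ord_le a (g j).

Definition ord_eq (a b : ord) : Prop := ord_le a b /\ ord_le b a.

Definition ord_zero : ord := sup_succ (fun e : Empty_set => match e with end).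

Definition ord_succ (a : ord) : ord := sup_succ (fun _ : unit => a).

Definition ord_is_sup (B : set ord) (a : ord) : Prop :=
  (forall b, B b -> ord_le b a) /\
  (forall c, (forall b, B b -> ord_le b c) -> ord_le a c).

(** * Trees of finite sequences of positive natural numbers *)

Notation posnat := {n : nat | (0 < n)%N}.

Definition leaf (T : set (seq posnat)) (s : seq posnat) : Prop :=
  forall t, t <> [::] -> ~ T (s ++ t).

(* [T] has no infinite branch *)
Definition tree_wf (T : set (seq posnat)) : Prop :=
  ~ exists b : nat -> posnat, forall k : nat, T (mkseq b k).

(* [rank_is T s a]: the rank of [s] in [T] is the ordinal [a].  The defining
   formula makes sense for every sequence [s]; when [T] is a tree and [s] is
   not in [T], it gives 0, because no extension of [s] is in [T]. *)
Inductive rank_is (T : set (seq posnat)) : seq posnat -> ord -> Prop :=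
| rank_is_leaf s a : leaf T s -> ord_eq a ord_zero -> rank_is T s a
| rank_is_node s a (r : posnat -> ord) : ~ leaf T s ->
    (forall n, T (rcons s n) -> rank_is T (rcons s n) (r n)) ->
    ord_is_sup [set ord_succ (r n) | n in [set n | T (rcons s n)]] a ->
    rank_is T s a.

Definition rank_infty (T : set (seq posnat)) : Prop := ~ tree_wf T.

Definition increasing (s : seq posnat) : bool := sorted ltn (map val s).

Definition increasing_part (T : set (seq posnat)) : set (seq posnat) :=
  [set s | T s /\ increasing s].

Definition father (s : seq posnat) : seq posnat := take (size s).-1 s.

Definition fset_of_seq (s : seq posnat) : {fset posnat} := [fset n in s]%fset.

(** * The ordinal of a set of finite nonempty sets of positive integers *)

Definition Fin : set {fset posnat} := [set tau | tau <> fset0].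

Definition residual (M : set {fset posnat}) (sigma : {fset posnat}) :
    set {fset posnat} :=
  [set tau | [/\ Fin tau, M (tau `|` sigma)%fset &
                 (tau `&` sigma)%fset = fset0]].

(* [Ord M <= a] and [Ord M < a] *)
Inductive Ord_le : set {fset posnat} -> ord -> Prop :=
| Ord_le_zero M a : ord_eq a ord_zero -> M = set0 -> Ord_le M a
| Ord_le_pos M a : ord_lt ord_zero a ->
    (forall n : posnat, Ord_lt (residual M [fset n]%fset) a) -> Ord_le M a
with Ord_lt : set {fset posnat} -> ord -> Prop :=
| Ord_lt_intro M a b : ord_lt b a -> Ord_le M b -> Ord_lt M a.

Definition Ord_is (M : set {fset posnat}) (a : ord) : Prop :=
  Ord_le M a /\ ~ Ord_lt M a.

Definition Ord_infty (M : set {fset posnat}) : Prop :=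
  forall a : ord, ~ Ord_le M a.

(** * Families of subsets of a metric space *)

Section MetricFamilies.
Context {R : realType} (X : metricType R).

Definition diam (A : set X) : \bar R :=
  ereal_sup [set e | exists x y, [/\ A x, A y & e = (mdist x y)%:E]].

Definition set_dist (A B : set X) : \bar R :=
  ereal_inf [set e | exists x y, [/\ A x, B y & e = (mdist x y)%:E]].

Definition uniformly_bounded (F : set (set X)) : Prop :=
  exists2 C : R, 0 <= C & forall A, F A -> (diam A <= C%:E)%E.

Definition r_disjoint (r : R) (F : set (set X)) : Prop :=
  forall A B, F A -> F B -> A <> B -> (r%:E <= set_dist A B)%E.

Definition covers (F : set (set X)) : Prop := \bigcup_(A in F) A = setT.

Definition A_of : set {fset posnat} :=
  [set sigma | Fin sigma /\
    ~ exists V : posnat -> set (set X),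
        [/\ forall i, i \in sigma -> r_disjoint (val i)%:R (V i),
            uniformly_bounded (\bigcup_(i in [set` sigma]) V i) &
            covers (\bigcup_(i in [set` sigma]) V i)]].

(* [tnth (in_tuple s) i] is the [i]-th term of [s] *)
Definition T_of : set (seq posnat) :=
  [set s |
    ~ exists V : 'I_(size s) -> set (set X),
        [/\ forall i, r_disjoint (val (tnth (in_tuple s) i))%:R (V i),
            uniformly_bounded (\bigcup_i V i) &
            covers (\bigcup_i V i)]].

Definition TA_of : set (seq posnat) :=
  [set s | increasing s /\
    (s <> [::] -> residual A_of (fset_of_seq (father s)) <> set0)].

End MetricFamilies.

(* Main.v *)
(** Enlarging the entries of a sequence, or deleting some of them, only makes a
    decomposition harder to find; so [T_of X] and [A_of X] are closed under both
    operations.  Hence [Ord (A_of X)^sigma] is the supremum of the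
    [Ord (A_of X)^(sigma, n) + 1] over the [n] exceeding all the terms of
    [sigma] (smaller new elements can be moved up), which is the recursion
    satisfied by the rank in [TA_of X].  The increasing part of [T_of X] omits
    only some leaves of [TA_of X], and each of these has a sibling which is not
    omitted, so that the suprema agree. *)

Require Import Defs.
From HB Require Import structures.
From mathcomp Require Import all_boot all_order all_algebra finmap.
From mathcomp Require Import all_classical all_reals all_analysis.

Set Implicit Arguments.
Unset Strict Implicit.
Unset Printing Implicit Defensive.

Import Order.TTheory GRing.Theory Num.Theory.

Local Open Scope classical_set_scope.

(** * The order of ordinals *)

Lemma ord_le_refl (a : ord) : ord_le a a.
Proof. by elim: a => J f IH i; exists i; exact: IH. Qed.

Lemma ord_le_trans (a b c : ord) : ord_le a b -> ord_le b c -> ord_le a c.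
Proof.
elim: a b c => J f IH [K g] [L h] ab bc i.
by have [j fg] := ab i; have [l gh] := bc j; exists l; apply: IH fg gh.
Qed.

Lemma ord_lt_le_trans (a b c : ord) : ord_lt a b -> ord_le b c -> ord_lt a c.
Proof.
case: b c => [K g] [L h] [j aj] bc.
by have [l gh] := bc j; exists l; apply: ord_le_trans aj gh.
Qed.

Lemma ord_le_lt_trans (a b c : ord) : ord_le a b -> ord_lt b c -> ord_lt a c.
Proof.
by case: c => L h ab [l bl]; exists l; apply: ord_le_trans ab bl.
Qed.

Lemma ord_zero_le (a : ord) : ord_le ord_zero a.
Proof. by case: a => J f []. Qed.

(** Presentations are not unique, so induction on [a] proves accessibility of every [b <= a]:
    anything below such a [b] is at most some member [f j] of the family presenting [a]. *)
Lemma ord_lt_wf : well_founded ord_lt.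
Proof.
move=> a; suff acc b : ord_le b a -> Acc ord_lt b by exact/acc/ord_le_refl.
elim: a b => J f IH b ba; constructor => c cb.
by have [j cj] := ord_lt_le_trans cb ba; apply: IH cj.
Qed.

(** * Finite sets and residuals *)

Definition Posnat (n : nat) (n_gt0 : (0 < n)%N) : posnat := exist _ n n_gt0.

Lemma FinP (tau : {fset posnat}) : Fin tau <-> exists n, n \in tau.
Proof. by split=> [/eqP/fset0Pn|[n ntau]] //; apply/eqP/fset0Pn; exists n. Qed.

Lemma residualP (M : set {fset posnat}) (sigma tau : {fset posnat}) :
  residual M sigma tau <->
  [/\ Fin tau, M (tau `|` sigma)%fset & forall n, n \in tau -> n \notin sigma].
Proof.
split=> [[tau0 Mtau /eqP]|[tau0 Mtau dtau]].
  by rewrite fsetI_eq0 => /fdisjointP.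
by split=> //; apply/eqP; rewrite fsetI_eq0; exact/fdisjointP.
Qed.

Lemma residual_set0 (sigma : {fset posnat}) : residual set0 sigma = set0.
Proof. by rewrite -subset0 => tau []. Qed.

Lemma residual_fset0 (M : set {fset posnat}) :
  M `<=` Fin -> residual M fset0 = M.
Proof.
move=> MFin; apply/seteqP; split=> tau /=; first by case; rewrite fsetU0.
by move=> Mtau; split; rewrite ?fsetU0 ?fsetI0//; exact: MFin.
Qed.

Lemma residual_residual (M : set {fset posnat}) (sigma : {fset posnat})
    (n : posnat) : n \notin sigma ->
  residual (residual M sigma) [fset n]%fset =
  residual M (sigma `|` [fset n])%fset.
Proof.
move=> nsigma; apply/seteqP; split=> tau.
  move=> /residualP[tau0 /residualP[_ Mtau dsigma] dn]; apply/residualP; split=> //.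
    by rewrite (fsetUC sigma) fsetUA.
  by move=> m mtau; rewrite inE negb_or dn// dsigma// inE mtau.
move=> /residualP[tau0 Mtau dtau]; apply/residualP; split=> //.
  apply/residualP; split.
  - by apply/FinP; exists n; rewrite !inE eqxx orbT.
  - by rewrite -fsetUA (fsetUC [fset n]%fset).
  - move=> m; rewrite !inE => /orP[/dtau|/eqP->//].
    by rewrite inE negb_or => /andP[].
by move=> m /dtau; rewrite inE negb_or => /andP[].
Qed.

(** * The ordinal of a family of finite sets *)

Lemma Ord_lt_witness (M : set {fset posnat}) (a : ord) :
  Ord_lt M a -> exists2 b, ord_lt b a & Ord_le M b.
Proof. by case=> {}M {}a b ba Mb; exists b. Qed.

(** [Ord_le_zero] reaches only [a = 0]; for positive [a], the residuals of the empty family are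
    again empty and induction applies at a smaller ordinal. *)
Lemma Ord_le_set0 (a : ord) : Ord_le set0 a.
Proof.
elim/(well_founded_ind ord_lt_wf): a => -[J f] IH.
have [[j _]|J0] := pselect (exists j : J, True).
  apply: Ord_le_pos; first by exists j; exact: ord_zero_le.
  move=> n; rewrite residual_set0; apply: (@Ord_lt_intro _ _ (f j)).
    by exists j; exact: ord_le_refl.
  by apply: IH; exists j; exact: ord_le_refl.
apply: Ord_le_zero => //; split; last exact: ord_zero_le.
by move=> i; case: J0; exists i.
Qed.

Lemma Ord_is_set0_le (a b : ord) : Ord_is set0 a -> ord_le a b.
Proof.
case: a => J f [_ min_a].
have [[j _]|J0] := pselect (exists j : J, True).
  case: min_a; apply: (@Ord_lt_intro _ _ ord_zero); last exact: Ord_le_set0.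
  by exists j; exact: ord_zero_le.
by case: b => K g i; case: J0; exists i.
Qed.

Lemma Ord_lt_residual (M : set {fset posnat}) (a : ord) (n : posnat) :
  M <> set0 -> Ord_le M a -> Ord_lt (residual M [fset n]%fset) a.
Proof. by move=> M0 Ma; case: Ma M0 => // ? ? _ -> []. Qed.

(** By induction on [a]: [phi] carries the residual of [N] at [n] into that of [M] at [phi n], since
    injectivity keeps images disjoint from [phi n]. *)
Lemma Ord_le_inj (M N : set {fset posnat}) (a : ord) (phi : posnat -> posnat) :
  injective phi -> (forall tau, N tau -> M (phi @` tau)%fset) ->
  Ord_le M a -> Ord_le N a.
Proof.
move=> phi_inj.
elim/(well_founded_ind ord_lt_wf): a M N => a IH M N NM Ma.
case: Ma NM IH => {M a} [M a a0 ->|M a a0 Ma] NM IH.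
  by apply: Ord_le_zero => //; rewrite -subset0 => tau /NM.
apply: Ord_le_pos => // n.
have [b ba Mb] := Ord_lt_witness (Ma (phi n)).
apply: (Ord_lt_intro ba).
apply: (IH b ba _ _ _ Mb) => tau /residualP[/FinP[m mtau] Ntau dtau].
apply/residualP; split.
- by apply/FinP; exists (phi m); rewrite mem_imfset.
- suff <- : (phi @` (tau `|` [fset n]) = phi @` tau `|` [fset phi n])%fset.
    exact: NM.
  apply/fsetP => k; apply/imfsetP/idP => /=.
    move=> [l + ->]; rewrite !inE mem_imfset//= => /orP[->//|/eqP ->].
    by rewrite eqxx orbT.
  rewrite !inE => /orP[/imfsetP[l /= ltau ->]|/eqP ->].
    by exists l; rewrite // inE ltau.
  by exists n; rewrite // !inE eqxx orbT.
- move=> _ /imfsetP[l /= /dtau + ->]; rewrite !inE.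
  by apply: contra_neq => /phi_inj.
Qed.

(** * Decompositions and their transfer *)

Section Decompositions.
Context {R : realType} (X : metricType R).

(** The common form of the decompositions in [A_of] and [T_of]; an arbitrary index type lets sets
    and sequences be compared by one lemma. *)
Definition decomposable (I : Type) (D : set I) (r : I -> nat) : Prop :=
  exists V : I -> set (set X),
    [/\ forall i, D i -> r_disjoint (r i)%:R (V i),
        uniformly_bounded (\bigcup_(i in D) V i) &
        covers (\bigcup_(i in D) V i)].

(* The [j]-th family is the [i]-th one for the unique [i] with [rel i j], and
   it is empty when there is no such [i]. *)
Lemma decomposable_transfer (I J : Type) (D : set I) (E : set J)
    (r : I -> nat) (q : J -> nat) (rel : I -> J -> Prop) :
  (forall i, D i -> exists2 j, E j & rel i j) ->
  (forall i i' j, rel i j -> rel i' j -> i = i') ->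
  (forall i j, rel i j -> (q j <= r i)%N) ->
  decomposable D r -> decomposable E q.
Proof.
move=> relT rel_inj le_qr [V [dV bV cV]].
pose W j : set (set X) := [set A | exists i, [/\ D i, rel i j & V i A]].
have WV : \bigcup_(j in E) W j = \bigcup_(i in D) V i.
  apply/seteqP; split=> A; first by move=> [j _ [i [Di _ VA]]]; exists i.
  by move=> [i Di VA]; have [j Ej ij] := relT i Di; exists j => //; exists i.
exists W; rewrite WV; split=> // j Ej A B [i [Di ij VA]] [i' [_ i'j VB]] AB.
rewrite -(rel_inj _ _ _ ij i'j) in VB.
apply: le_trans (dV i Di A B VA VB AB).
by rewrite lee_fin ler_nat le_qr.
Qed.

Lemma T_ofE (s : seq posnat) :
  T_of X s <->
  ~ decomposable [set: 'I_(size s)] (fun i => val (tnth (in_tuple s) i)).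
Proof.
by split; apply: contra_not => -[V [dV bV cV]]; exists V; split=> // *;
  exact: dV.
Qed.

(** Each [j] in [tau] receives the family of [psi j], which is [j]-disjoint because [j <= psi j], or
    no sets if [psi j] is outside [sigma]. This covers both raising and deleting elements. *)
Lemma A_of_transfer (sigma tau : {fset posnat}) (psi : posnat -> posnat) :
  Fin sigma -> (sigma `<=` psi @` tau)%fset ->
  {in tau, forall n, (val n <= val (psi n))%N} ->
  A_of X tau -> A_of X sigma.
Proof.
move=> sigma0 sub_sigma le_psi [_ tauA]; split=> //; apply: contra_not tauA.
apply: (@decomposable_transfer _ _ [set` sigma] [set` tau] val val
  (fun i j => j \in tau /\ i = psi j)).
- by move=> i /= /(fsubsetP sub_sigma) /imfsetP[j /= jtau ->]; exists j.
- by move=> i i' j [_ ->] [_ ->].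
- by move=> i j [/le_psi + ->].
Qed.

Lemma A_of_subset (sigma tau : {fset posnat}) :
  Fin sigma -> (sigma `<=` tau)%fset -> A_of X tau -> A_of X sigma.
Proof.
move=> sigma0 sub; apply: (A_of_transfer (psi := id)) => //.
by apply: fsubset_trans sub _; apply/fsubsetP => x xtau; apply/imfsetP; exists x.
Qed.

(** A repeated term would allow two families at one scale; without repetitions, positions in [s] and
    elements of its set correspond bijectively. *)
Lemma T_of_A_of (s : seq posnat) :
  s <> [::] -> uniq s -> A_of X (fset_of_seq s) <-> T_of X s.
Proof.
move=> s0 us; rewrite T_ofE; split.
  move=> [_]; apply: contra_not.
  apply: (decomposable_transfer (rel := fun i n => n = tnth (in_tuple s) i)).
  - move=> i _; exists (tnth (in_tuple s) i) => //.
    by rewrite /= /fset_of_seq !inE mem_tnth.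
  - by move=> i i' n -> /tuple_uniqP; apply.
  - by move=> i n ->.
move=> Ts; split.
  case: s s0 {us Ts} => // x s _; apply/eqP/fset0Pn.
  by exists x; rewrite !inE eqxx.
apply: contra_not Ts.
apply: (decomposable_transfer (rel := fun n i => n = tnth (in_tuple s) i)).
- move=> n /=; rewrite /fset_of_seq !inE => /(@tnthP _ _ (in_tuple s)) [i ->].
  by exists i.
- by move=> n n' i -> ->.
- by move=> n i ->.
Qed.

Lemma T_of_transfer (p : posnat) (s t : seq posnat) :
  (size s <= size t)%N ->
  (forall i, (i < size s)%N -> (val (nth p t i) <= val (nth p s i))%N) ->
  T_of X t -> T_of X s.
Proof.
move=> le_st le_ts; rewrite !T_ofE; apply: contra_not.
apply: (decomposable_transfer (rel :=
  fun (i : 'I_(size s)) (j : 'I_(size t)) => i = j :> nat)).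
- by move=> i _; exists (widen_ord le_st i).
- by move=> i i' j ij i'j; apply: ord_inj; rewrite ij i'j.
- by move=> i j ij; rewrite !(tnth_nth p) /= -ij; exact: le_ts.
Qed.

End Decompositions.

(** * Well founded trees and increasing sequences *)

(** A node violating [P] has a child violating [P]; iterating a choice of such children from [s]
    gives an infinite branch. *)
Lemma tree_wf_ind (T : set (seq posnat)) (P : seq posnat -> Prop) :
  tree_wf T -> (forall s t, T (s ++ t) -> T s) ->
  (forall s, T s -> (forall n, T (rcons s n) -> P (rcons s n)) -> P s) ->
  forall s, T s -> P s.
Proof.
move=> Twf Tprefix IH s Ts; apply: contrapT => nPs; apply: Twf.
have /choice[g gP] : forall t, exists n : posnat, T t -> ~ P t ->
    T (rcons t n) /\ ~ P (rcons t n).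
  move=> t.
  have [[n [Tn nPn]]|noext] := pselect (exists n, T (rcons t n) /\ ~ P (rcons t n)).
    by exists n.
  exists (Posnat (isT : (0 < 1)%N)) => Tt [] //; apply: IH => // n Tn.
  by apply: contrapT => nPn; apply: noext; exists n.
pose u k := iter k (fun t => rcons t (g t)) s.
have uP k : T (u k) /\ ~ P (u k) by elim: k => //= k [Tu nPu]; exact: gP.
have size_u k : size (u k) = (size s + k)%N.
  by elim: k => [|k IHk] /=; rewrite ?addn0// size_rcons IHk addnS.
have nth_u x m j i : (i < size (u m))%N -> nth x (u (m + j)) i = nth x (u m) i.
  move=> im; elim: j => [|j <-]; first by rewrite addn0.
  rewrite addnS /= nth_rcons ifT// size_u; apply: leq_trans im _.
  by rewrite size_u leq_add2l leq_addr.
pose x0 : posnat := Posnat (isT : (0 < 1)%N).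
(* The branch starts at the root, so it includes [s]. Stage [i.+1] already has more than [i] terms,
   and later stages do not change them. *)
exists (fun i => nth x0 (u i.+1) i) => k.
suff -> : mkseq (fun i => nth x0 (u i.+1) i) k = take k (u k).
  by apply: (Tprefix _ (drop k (u k))); rewrite cat_take_drop; case: (uP k).
have size_take_u : size (take k (u k)) = k.
  by rewrite size_takel// size_u leq_addl.
apply: (@eq_from_nth _ x0); rewrite size_mkseq ?size_take_u// => i ik.
rewrite nth_mkseq// nth_take// -(subnKC ik) nth_u// size_u.
by rewrite addnS ltnS leq_addl.
Qed.

Lemma increasing_rcons (s : seq posnat) (n : posnat) :
  increasing (rcons s n) = increasing s && all (fun m => val m < val n)%N s.
Proof.
rewrite /increasing map_rcons !(sorted_pairwise ltn_trans) pairwise_rcons.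
by rewrite all_map andbC.
Qed.

Lemma increasing_uniq (s : seq posnat) : increasing s -> uniq s.
Proof. by move=> /(sorted_uniq ltn_trans ltnn) /map_uniq. Qed.

Lemma increasing_mkseq (b : nat -> posnat) (k : nat) :
  (forall i, val (b i) < val (b i.+1))%N -> increasing (mkseq b k).
Proof.
move=> b_lt; elim: k => // k IH; rewrite mkseqS increasing_rcons IH /=.
apply/allP => m /mapP[i]; rewrite mem_iota /= add0n => ik ->.
elim: k ik {IH} => // k IH; rewrite ltnS leq_eqVlt => /predU1P[->|/IH ik].
  exact: b_lt.
exact: ltn_trans ik (b_lt k).
Qed.

Lemma fset_of_seq_rcons (s : seq posnat) (n : posnat) :
  fset_of_seq (rcons s n) = (fset_of_seq s `|` [fset n])%fset.
Proof. by apply/fsetP => m; rewrite !inE /= mem_rcons inE orbC. Qed.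

Lemma fset_of_seq_nil : fset_of_seq [::] = fset0.
Proof. by apply/fsetP => m; rewrite !inE. Qed.

Lemma father_rcons (s : seq posnat) (n : posnat) : father (rcons s n) = s.
Proof. by rewrite /father size_rcons /= -cats1 take_size_cat. Qed.

Lemma seq_bound (s : seq posnat) :
  exists n : posnat, forall m, m \in s -> (val m < val n)%N.
Proof.
elim: s => [|x s [n IH]]; first by exists (Posnat (isT : (0 < 1)%N)).
have pos : (0 < val n + (val x).+1)%N by rewrite addnS.
exists (Posnat pos) => m; rewrite inE => /predU1P[->|/IH mn] /=.
  exact: leq_addl.
exact: leq_trans mn (leq_addr _ _).
Qed.

(** * Comparison of the trees *)

Section Trees.
Context {R : realType} (X : metricType R).
Local Notation A := (A_of X).
Local Notation TA := (TA_of X).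
Local Notation Tincr := (increasing_part (T_of X)).

Lemma residual_A_of_antitone (sigma tau : {fset posnat}) :
  (sigma `<=` tau)%fset -> residual A tau `<=` residual A sigma.
Proof.
move=> sub rho /residualP[rho0 Arho drho]; apply/residualP; split=> //.
  apply: A_of_subset Arho; last exact: fsetUS.
  by have [m mrho] := (FinP _).1 rho0; apply/FinP; exists m; rewrite inE mrho.
by move=> m /drho; apply: contra; exact: (fsubsetP sub).
Qed.

Lemma TA_of_rcons (s : seq posnat) (n : posnat) :
  TA (rcons s n) <->
  increasing (rcons s n) /\ residual A (fset_of_seq s) <> set0.
Proof.
rewrite /TA_of /= father_rcons; split=> -[incr A0]; split=> //.
by apply: A0; case: s {incr}.
Qed.

Lemma TA_of_prefix (s t : seq posnat) : TA (s ++ t) -> TA s.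
Proof.
elim/last_ind: t => [|t x IH]; first by rewrite cats0.
rewrite -rcons_cat => /TA_of_rcons[]; move: IH.
elim/last_ind: (s ++ t) => [|{}t y _] IH; first by move=> *; exact: IH.
rewrite increasing_rcons => /andP[incr _] A0; apply: IH; apply/TA_of_rcons.
split=> //; apply: contra_not A0 => A0; rewrite -subset0 -A0.
by apply: residual_A_of_antitone; rewrite fset_of_seq_rcons fsubsetUl.
Qed.

(** The singleton of the last term of [s] witnesses that the residual at the father is nonempty. *)
Lemma increasing_T_of_TA_of : Tincr `<=` TA.
Proof.
move=> s [Ts incr]; split=> // s0.
have As : A (fset_of_seq s) by apply/T_of_A_of => //; exact: increasing_uniq.
case/lastP: s s0 incr As {Ts} => // s n _.
rewrite father_rcons increasing_rcons => /andP[_ /allP ltn] As.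
apply/eqP/set0P; exists [fset n]%fset; apply/residualP; split.
- by apply/FinP; exists n; rewrite inE.
- by rewrite fsetUC -fset_of_seq_rcons.
- move=> m; rewrite !inE => /eqP ->.
  by apply/negP => /ltn; rewrite ltnn.
Qed.

(** The set of the sequence is a subset of a member of [A]. Thus nodes of [TA] missing from [Tincr]
    have empty residual. *)
Lemma T_of_residual (s : seq posnat) (n : posnat) :
  increasing (rcons s n) ->
  residual A (fset_of_seq (rcons s n)) <> set0 -> T_of X (rcons s n).
Proof.
move=> incr /eqP/set0P[tau /residualP[_ Atau _]].
apply/T_of_A_of; [by case: (s) | exact: increasing_uniq |].
apply: A_of_subset Atau; last exact: fsubsetUr.
by apply/FinP; exists n; rewrite !inE mem_rcons inE eqxx.
Qed.

(** Take [m] in some [tau] of the residual, raise it to [n] and delete the rest of [tau]. This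
    provides the siblings that are not omitted. *)
Lemma T_of_rcons_large (s : seq posnat) :
  residual A (fset_of_seq s) <> set0 ->
  exists m : posnat, forall n, (val m <= val n)%N -> increasing (rcons s n) ->
    T_of X (rcons s n).
Proof.
move=> /eqP/set0P[tau /residualP[/FinP[m mtau] Atau dtau]].
exists m => n mn incr; apply/T_of_A_of; [by case: (s) | exact: increasing_uniq |].
apply: (A_of_transfer (psi := fun k => if k == m then n else k)) Atau.
- by apply/FinP; exists n; rewrite !inE mem_rcons inE eqxx.
- rewrite fset_of_seq_rcons; apply/fsubsetP => k; rewrite in_fsetU in_fset1.
  move=> /orP[ks|/eqP->]; apply/imfsetP => /=.
    exists k; first by rewrite in_fsetU ks orbT.
    by case: eqP => // km; move: (dtau _ mtau); rewrite -km ks.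
  by exists m; rewrite ?eqxx// in_fsetU mtau.
- by move=> k _; case: eqP => // ->.
Qed.

(* Replacing [n] by [p] could make it collide with an element of [tau]; so all
   the elements of [tau] are first shifted past [p]. *)
Lemma Ord_le_raise (sigma : {fset posnat}) (n p : posnat) (a : ord) :
  (val n <= val p)%N -> (forall m, m \in sigma -> (val m < val p)%N) ->
  Ord_le (residual A (sigma `|` [fset p])%fset) a ->
  Ord_le (residual (residual A sigma) [fset n]%fset) a.
Proof.
move=> np sigmap.
have shift_pos (m : posnat) : (0 < val m + val p)%N.
  by rewrite addn_gt0 (valP m).
pose shift m : posnat := Posnat (shift_pos m).
have lt_shift m : (val p < val (shift m))%N.
  by rewrite /= -[ltnLHS]add0n ltn_add2r; exact: (valP m).
apply: (@Ord_le_inj _ _ _ shift).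
  by move=> m k /(congr1 val) /= /addIn /val_inj.
move=> tau /residualP[/FinP[m mtau] /residualP[_ Atau dsigma] dn].
have dtau k : k \in tau -> k \notin sigma.
  by move=> ktau; apply: dsigma; rewrite inE ktau.
have nsigma : n \notin sigma by apply: dsigma; rewrite !inE eqxx orbT.
apply/residualP; split.
- by apply/FinP; exists (shift m); apply/imfsetP; exists m.
- apply: (A_of_transfer (psi := fun k => if k \in sigma then k
      else if k == n then p else shift k)) Atau.
  + by apply/FinP; exists p; rewrite !inE eqxx !orbT.
  + apply/fsubsetP => k; rewrite !in_fsetU in_fset1 => /or3P[].
    * move=> /imfsetP[l /= ltau ->]; apply/imfsetP; exists l => /=.
        by rewrite !in_fsetU ltau.
      rewrite (negbTE (dtau _ ltau)) ifF//.
      by move: (dn _ ltau); rewrite in_fset1 => /negbTE.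
    * move=> ksigma; apply/imfsetP; exists k => /=; last by rewrite ksigma.
      by rewrite !in_fsetU ksigma orbT.
    * move=> /eqP ->; apply/imfsetP; exists n => /=.
        by rewrite !in_fsetU in_fset1 eqxx orbT.
      by rewrite (negbTE nsigma) eqxx.
  + move=> k _; case: ifP => // _; case: eqP => [-> //|_].
    exact: leq_addr.
- move=> _ /imfsetP[l _ ->]; rewrite in_fsetU in_fset1 negb_or.
  apply/andP; split; last by rewrite -val_eqE gtn_eqF.
  by apply/negP => /sigmap; rewrite ltnNge ltnW.
Qed.

(** * Equality of the ordinal and the two ranks *)

Lemma rank_TA_of : tree_wf TA -> forall s, TA s ->
  exists a, [/\ Ord_is (residual A (fset_of_seq s)) a,
                rank_is TA s a & rank_is Tincr s a].
Proof.
move=> TAwf; apply: tree_wf_ind => // [|s TAs IH]; first exact: TA_of_prefix.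
(* If the residual is empty, [s] is a leaf of both trees and all three values are 0. *)
have [A0|A0] := pselect (residual A (fset_of_seq s) = set0).
  have leafTA : leaf TA s.
    move=> [//|x t _]; rewrite -cat_rcons => /TA_of_prefix /TA_of_rcons.
    by rewrite A0 => -[].
  have zz : ord_eq ord_zero ord_zero by split; exact: ord_le_refl.
  exists ord_zero; split.
  - by rewrite A0; split; [exact: Ord_le_set0|move=> /Ord_lt_witness[b []]].
  - exact: rank_is_leaf.
  - apply: rank_is_leaf => // t t0 /increasing_T_of_TA_of; exact: leafTA.
have /choice[r rP] : forall n, exists b, TA (rcons s n) ->
    [/\ Ord_is (residual A (fset_of_seq (rcons s n))) b,
        rank_is TA (rcons s n) b & rank_is Tincr (rcons s n) b].
  move=> n; have [/IH[a aP]|nTA] := pselect (TA (rcons s n)).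
    by exists a.
  by exists ord_zero.
have [n0 n0s] := seq_bound s.
have incr_s n : (val n0 <= val n)%N -> increasing (rcons s n).
  move=> n0n; rewrite increasing_rcons TAs.1; apply/allP => m /n0s mn0.
  exact: leq_trans mn0 n0n.
have [m0 m0P] := T_of_rcons_large A0.
have above (n : posnat) : exists p : posnat, [/\ (val n <= val p)%N, Tincr (rcons s p) &
    TA (rcons s p)].
  (* The summand [n0] puts the new term above those of [s], and [m0] makes [T_of_rcons_large]
     apply. *)
  have pos : (0 < val n + val n0 + val m0)%N by rewrite addn_gt0 (valP m0) orbT.
  exists (Posnat pos); have incr : increasing (rcons s (Posnat pos)).
    by apply: incr_s; rewrite /= -addnA addnCA leq_addr.
  split; first by rewrite /= -addnA leq_addr.
    by split=> //; apply: m0P => //=; exact: leq_addl.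
  exact/TA_of_rcons.
pose a := sup_succ (fun n : {n | TA (rcons s n)} => r (sval n)).
have r_lt n : TA (rcons s n) -> ord_lt (r n) a.
  by move=> TAn; exists (exist _ n TAn); exact: ord_le_refl.
have lub (c : ord) : (forall n, TA (rcons s n) -> ord_le (ord_succ (r n)) c) ->
    ord_le a c.
  case: c => K h hP [n TAn] /=.
  by have [] := hP n TAn tt; move=> k; exists k.
have [p [_ Tp TAp]] := above n0.
exists a; split.
- split.
    apply: Ord_le_pos; first exact: ord_le_lt_trans (ord_zero_le _) (r_lt _ TAp).
    (* Here [n] may be smaller than some terms of [s]; raising it to [q] reduces to a child. *)
    move=> n; have [q [nq _ TAq]] := above n.
    apply: (Ord_lt_intro (r_lt _ TAq)); apply: (Ord_le_raise nq).
      move=> m; rewrite !inE /= => ms.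
      have /TA_of_rcons[+ _] := TAq.
      by rewrite increasing_rcons => /andP[_ /allP]; exact.
    by rewrite -fset_of_seq_rcons; case: (rP q TAq) => -[].
  (* An ordinal bound [b < a] satisfies [b <= r n] for some child, whose own ordinal would then be
     below [r n], against minimality. *)
  move=> /Ord_lt_witness[b [[n TAn] /= brn] Mb].
  have [[_ min_rn] _ _] := rP n TAn; apply: min_rn.
  have : Ord_lt (residual (residual A (fset_of_seq s)) [fset n]%fset) b.
    exact: Ord_lt_residual.
  rewrite residual_residual -?fset_of_seq_rcons; last first.
    have /TA_of_rcons[+ _] := TAn; rewrite increasing_rcons => /andP[_ /allP ns].
    by rewrite !inE /=; apply/negP => /ns; rewrite ltnn.
  move=> /Ord_lt_witness[d dc Md]; apply: Ord_lt_intro Md; exact: ord_lt_le_trans dc brn.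
- apply: (@rank_is_node _ _ _ r).
  + by move=> /(_ [:: p]); rewrite cats1; apply.
  + by move=> n /rP[].
  + split=> [_ [n TAn <-] [] /=|c ub]; first exact: r_lt.
    by apply: lub => n TAn; apply: ub; exists n.
- apply: (@rank_is_node _ _ _ r).
  + by move=> /(_ [:: p]); rewrite cats1; apply.
  + by move=> n /increasing_T_of_TA_of /rP[].
  + split=> [_ [n /increasing_T_of_TA_of TAn <-] [] /=|c ub]; first exact: r_lt.
    apply: lub => n TAn.
    have [Tn|nTn] := pselect (Tincr (rcons s n)); first by apply: ub; exists n.
    (* A child outside [Tincr] has ordinal 0, so its sibling [p] in [Tincr] dominates it. *)
    have An0 : residual A (fset_of_seq (rcons s n)) = set0.
      apply: contrapT => An; apply: nTn; have /TA_of_rcons[incr _] := TAn.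
      by split=> //; exact: T_of_residual.
    apply: (@ord_le_trans _ (ord_succ (r p))); last by apply: ub; exists p.
    move=> _; exists tt; apply: Ord_is_set0_le.
    by rewrite -An0; case: (rP n TAn).
Qed.

(** * The infinite case *)

Lemma Ord_infty_rank_infty : Ord_infty A <-> rank_infty TA.
Proof.
have fset0E : residual A (fset_of_seq [::]) = A.
  by rewrite fset_of_seq_nil residual_fset0// => sigma [].
split=> [Oinf TAwf|/contrapT[b bTA]].
  have TA0 : TA [::] by [].
  have [a [[+ _] _ _]] := rank_TA_of TAwf TA0.
  by rewrite fset0E; exact: Oinf.
(* Along an infinite branch all residuals are nonempty, so a bound at length [k] forces a smaller
   one at length [k.+1]: an infinite descent. *)
suff noOrd a k : ~ Ord_le (residual A (fset_of_seq (mkseq b k))) a.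
  by move=> a; rewrite -fset0E; exact: (noOrd a 0%N).
elim/(well_founded_ind ord_lt_wf): a k => a IH k.
have := bTA k.+1; rewrite mkseqS => /TA_of_rcons[].
rewrite increasing_rcons => /andP[_ /allP lt_bk] A0.
move=> /(Ord_lt_residual (b k) A0).
rewrite residual_residual; last first.
  by rewrite !inE /=; apply/negP => /lt_bk; rewrite ltnn.
rewrite -fset_of_seq_rcons -mkseqS => /Ord_lt_witness[c ca].
exact: IH.
Qed.

Lemma rank_infty_TA_T : rank_infty TA <-> rank_infty (T_of X).
Proof.
split=> /contrapT[b bT]; apply.
  (* Length [k.+2] in [TA] makes the residual at length [k.+1] nonempty, so that prefix is in
     [T_of X]; its last term is then dropped. Using [k.+1] avoids the empty sequence when [k] is
     0. *)
  exists b => k; have := bT k.+2; rewrite mkseqS => /TA_of_rcons[incr A0].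
  apply: (@T_of_transfer _ _ (b 0%N) _ (mkseq b k.+1)).
  - by rewrite !size_mkseq.
  - move=> i; rewrite size_mkseq => ik.
    by rewrite !nth_mkseq// leqW.
  - rewrite mkseqS; apply: T_of_residual; last by rewrite -mkseqS.
    by move: incr; rewrite increasing_rcons mkseqS => /andP[].
(* The partial sums of [b] dominate [b] and increase strictly, all terms being positive. *)
have c_pos k : (0 < \sum_(i < k.+1) val (b i))%N.
  by rewrite big_ord_recl addn_gt0 (valP (b 0%N)).
pose c k : posnat := Posnat (c_pos k).
exists c => k; apply: increasing_T_of_TA_of; split.
  apply: (@T_of_transfer _ _ (b 0%N) _ (mkseq b k)); rewrite ?size_mkseq//.
  move=> i ik; rewrite !nth_mkseq//= big_ord_recr /=; exact: leq_addl.
apply: increasing_mkseq => i /=; rewrite [ltnRHS]big_ord_recr /=.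
by rewrite -[ltnLHS]addn0 ltn_add2l (valP (b i.+1)).
Qed.

End Trees.

Theorem theorem2 (R : realType) (X : metricType R) :
  (tree_wf (TA_of X) ->
     tree_wf (increasing_part (T_of X)) /\
     forall sigma : seq posnat, TA_of X sigma ->
       exists a : ord,
         [/\ Ord_is (residual (A_of X) (fset_of_seq sigma)) a,
             rank_is (TA_of X) sigma a &
             rank_is (increasing_part (T_of X)) sigma a]) /\
  (Ord_infty (A_of X) <-> rank_infty (TA_of X)) /\
  (rank_infty (TA_of X) <-> rank_infty (T_of X)).
Proof.
split; last by split; [exact: Ord_infty_rank_infty|exact: rank_infty_TA_T].
move=> TAwf; split; last exact: rank_TA_of.
by apply: contra_not TAwf => -[b bT]; exists b => k; exact/increasing_T_of_TA_of.
Qed.
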